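(* Let $\mathbb{K}$ be a countably infinite field and let $A,B,C\subset\mathbb{K}$ be sets of positive upper Banach density. Then $$\left\{(x^3yz,\,xz) : x\in A-A,\ y\in B-B,\ z\in C-C\right\}=\{(s,t)\in\mathbb{K}^2 : t\neq0\}\cup\{(0,0)\}.$$
   Context: Here $A-A=\{x-y:x,y\in A\}$. Upper Banach density is taken in the additive group $(\mathbb{K},+)$: a Følner sequence is a sequence $(F_n)$ of non-empty finite subsets of $\mathbb{K}$ with $|F_n\cap(F_n+b)|/|F_n|\to1$ for every $b\in\mathbb{K}$, and $d^*(E)=\sup_{(F_n)}\limsup_{n\to\infty}|E\cap F_n|/|F_n|$, the supremum being over all such sequences. *)

(* Defs.v *)
From HB Require Import structures.
From mathcomp Require Import all_boot all_order all_algebra finmap.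
From mathcomp Require Import all_classical all_reals all_analysis.

Set Implicit Arguments.
Unset Strict Implicit.
Unset Printing Implicit Defensive.

Import Order.TTheory GRing.Theory Num.Theory numFieldNormedType.Exports.

Local Open Scope classical_set_scope.
Local Open Scope fset_scope.
Local Open Scope ring_scope.

Definition difference_set (G : zmodType) (A : set G) : set G :=
  [set x - y | x in A & y in A].

Definition folner_ratio (R : realType) (G : zmodType) (F : nat -> {fset G})
    (b : G) (n : nat) : R :=
  #|` F n `&` [fset x + b | x in F n]|%:R / #|` F n|%:R.

Definition folner_sequence (R : realType) (G : zmodType)
    (F : nat -> {fset G}) : Prop :=
  (forall n, F n != fset0) /\
  (forall b : G, folner_ratio R F b n @[n --> \oo] --> (1 : R)).

Definition relative_density (R : realType) (G : zmodType) (E : set G)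
    (F : nat -> {fset G}) (n : nat) : R :=
  #|` [fset x in F n | x \in E]|%:R / #|` F n|%:R.

(* The supremum is taken in the extended reals. Every relative density lies in
   [0, 1], and a countable abelian group has a Folner sequence, so the value is
   then a real number in [0, 1]. *)
Definition upper_banach_density (R : realType) (G : zmodType) (E : set G)
    : \bar R :=
  ereal_sup [set limn_esup (fun n => (relative_density R E F n)%:E)
            | F in [set F | folner_sequence R F]].

(* Main.v *)
Require Import Defs.
From HB Require Import structures.
From mathcomp Require Import all_boot all_order all_algebra finmap.
From mathcomp Require Import all_classical all_reals all_analysis.
From mathcomp Require Import ring lra zify.

Import Order.TTheory GRing.Theory Num.Theory numFieldNormedType.Exports.

Local Open Scope classical_set_scope.
Local Open Scope ring_scope.

(** Write t for the second coordinate, t != 0, and s for the first.  The content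
    is to find x != 0 with x in A - A, t / x in C - C and
    (s / t) / x ^ 2 in B - B; substituting x = 1 / v, one needs a v with
    1 / v in A - A, t v in C - C and (s / t) v ^ 2 in B - B.

    Each difference set is seen through its correlation function
    phi r = m (E /\ (E - r)), for m an invariant mean giving E measure
    delta > 0 (density_correlation).  It takes values in [0, 1], it is
    positive definite, even after subtracting the constant delta ^ 2, and its
    support lies in E - E.  Only these properties are used afterwards.

    Linear conditions.  Positivity forbids more than 1 / delta ^ 2 points whose
    pairwise differences all avoid the support of phi
    (correlation_delta_star).  By Ramsey's theorem this largeness property
    passes to intersections of finitely many dilates, and a set having it meets
    every dilate of a suitable finite set (delta_star_syndetic).  Thus
    E - E is multiplicatively thickly syndetic, and the v satisfying the first
    two conditions contain a dilate w D of any prescribed finite set D of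
    nonzero elements (delta_star_inverse).

    Quadratic condition.  It remains to know a finite D, depending only on the
    density of B, such that v ^ 2 lies in the support of every correlation
    function of that density for some v in D: this is then applied to the
    correlation function r |-> phi_B (w ^ 2 (s / t) r), and uniformity in w is
    what lets D be chosen before w.  This uniform Sarkozy theorem
    (square_recurrence) is proved by almost orthogonality.  Averaging over
    squares of a long almost invariant set kills any prescribed finite set of
    translations, by van der Corput's differencing (square_averages); hence
    there are M finite sets D_k such that, for j < k, the averages of
    phi (x ^ 2 - y ^ 2) over x in D_k and y in D_j do not exceed the average of
    phi (x ^ 2) by more than e.  If phi vanished at all the squares, the M
    averages over squares of the D_k would be almost orthogonal vectors of norm
    at most 1 in the form defined by phi, while their sum has square norm at
    least (delta M) ^ 2, which is absurd for M large.  In characteristic 2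
    squaring is additive and the linear argument applies to squares. *)

(** * Invariant means from Folner sequences *)

Definition bounded {R : realType} {T : Type} (f : T -> R) : Prop :=
  exists M : R, forall x, `|f x| <= M.

Lemma bounded_cst {R : realType} {T : Type} (a : R) :
  bounded (fun _ : T => a).
Proof. by exists `|a| => x. Qed.

Lemma boundedD {R : realType} {T : Type} (f g : T -> R) :
  bounded f -> bounded g -> bounded (fun x => f x + g x).
Proof.
move=> [M fM] [N gN]; exists (M + N) => x.
by rewrite (le_trans (ler_normD _ _))// lerD.
Qed.

Lemma boundedM {R : realType} {T : Type} (f g : T -> R) :
  bounded f -> bounded g -> bounded (fun x => f x * g x).
Proof.
move=> [M fM] [N gN]; exists (M * N) => x.
by rewrite normrM ler_pM.
Qed.

Lemma bounded_sum {R : realType} {T I : Type} (s : seq I) (f : I -> T -> R) :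
  (forall i, bounded (f i)) -> bounded (fun x => \sum_(i <- s) f i x).
Proof.
move=> fb; elim: s => [|i s IHs].
  by exists 0 => x; rewrite big_nil normr0.
have [M hM] := boundedD _ _ (fb i) IHs.
by exists M => x; rewrite big_cons; exact: hM.
Qed.

Definition average {R : realType} {K : choiceType} (F : {fset K})
    (f : K -> R) : R :=
  (\sum_(x <- F) f x) / #|` F|%:R.

Lemma averageD {R : realType} {K : choiceType} (F : {fset K}) (f g : K -> R) :
  average F (fun x => f x + g x) = average F f + average F g.
Proof. by rewrite /average big_split mulrDl. Qed.

Lemma averageZ {R : realType} {K : choiceType} (F : {fset K}) a (f : K -> R) :
  average F (fun x => a * f x) = a * average F f.
Proof. by rewrite /average -mulr_sumr mulrA. Qed.

Lemma average_cst {R : realType} {K : choiceType} (F : {fset K}) (a : R) :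
  F != fset0 -> average F (fun=> a) = a.
Proof.
rewrite -cardfs_gt0 => F0.
rewrite /average big_const_seq count_predT iter_addr_0.
by rewrite -(mulr_natr a) mulfK// pnatr_eq0 -lt0n.
Qed.

Lemma le_average {R : realType} {K : choiceType} (F : {fset K}) (f g : K -> R) :
  (forall x, f x <= g x) -> average F f <= average F g.
Proof. by move=> fg; rewrite ler_wpM2r ?invr_ge0// ler_sum. Qed.

Lemma average_bound {R : realType} {K : choiceType} (F : {fset K})
    (f : K -> R) (M : R) :
  F != fset0 -> (forall x, `|f x| <= M) -> `|average F f| <= M.
Proof.
move=> F0 fM; rewrite ler_norml -{1}(average_cst F (- M) F0).
rewrite -{2}(average_cst F M F0).
apply/andP; split; apply: le_average => x; have := fM x; rewrite ler_norml;
  by case/andP.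
Qed.

(** Passing from F to its translate only changes the sum on the two differences
    of these sets, which have the same cardinal; the right-hand side is the
    defect of the Folner ratio from 1. *)
Lemma average_shift {R : realType} {K : zmodType} (F : {fset K})
    (b : K) (f : K -> R) (M : R) :
  F != fset0 -> (forall x, `|f x| <= M) ->
  `|average F (fun x => f (x + b)) - average F f|
    <= 2 * M * (1 - #|` (F `&` [fset (x + b)%R | x in F])%fset|%:R / #|` F|%:R).
Proof.
move=> F0 fM; set G := [fset (x + b)%R | x in F]%fset.
have cF : 0 < #|` F|%:R :> R by rewrite ltr0n cardfs_gt0.
have cG : #|` G| = #|` F| by rewrite card_imfset //; exact: addIr.
have -> : average F (fun x => f (x + b)) = (\sum_(y <- G) f y) / #|` F|%:R.
  rewrite /average /G big_imfset//=.
  by move=> x y _ _; exact: addIr.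
rewrite /average -mulrBl normrM [X in _ * X]gtr0_norm ?invr_gt0//.
have bnd (A : {fset K}) : `|\sum_(x <- A) f x| <= M * #|` A|%:R.
  apply: (le_trans (ler_norm_sum _ _ _)).
  apply: (le_trans (ler_sum _ (fun i _ => fM i))).
  by rewrite big_const_seq count_predT iter_addr_0 mulr_natr.
have split (A B : {fset K}) : \sum_(x <- A) f x
    = \sum_(x <- (A `&` B)%fset) f x + \sum_(x <- (A `\` B)%fset) f x.
  rewrite (big_fsetID _ (mem B)); congr (_ + _); apply: eq_fbigl => x.
    by rewrite !inE.
  by rewrite !inE andbC.
rewrite (split G F) (split F G) fsetIC opprD addrACA subrr add0r.
have ratioE (a : R) : 1 - a / #|` F|%:R = (#|` F|%:R - a) / #|` F|%:R.
  by rewrite mulrBl divff ?lt0r_neq0.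
rewrite ratioE mulrA ler_pM2r ?invr_gt0//.
apply: (le_trans (ler_normB _ _)).
have dG : #|` (G `\` F)%fset|%:R = #|` F|%:R - #|` (F `&` G)%fset|%:R :> R.
  by rewrite -cG -(cardfsID F G) fsetIC natrD addrAC subrr add0r.
have dF : #|` (F `\` G)%fset|%:R = #|` F|%:R - #|` (F `&` G)%fset|%:R :> R.
  by rewrite -[in X in X - _](cardfsID G F) natrD addrAC subrr add0r.
rewrite -dF -mulrA mulrDl mul1r; apply: lerD; last exact: bnd.
by rewrite dF -dG; exact: bnd.
Qed.

(** An upper limit is only attained frequently.  Restricting to the
    indices with large values and refining to an ultrafilter turns this into a
    bound that holds eventually, and makes every bounded sequence converge. *)
Lemma limn_esup_ultra {R : realType} (u : nat -> R) (d : R) :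
  (d%:E < limn_esup (fun n => (u n)%:E))%E ->
  exists U : set_system nat,
    [/\ UltraFilter U, \oo `<=` U & U [set n | d <= u n]].
Proof.
move=> du; pose S := [set n | d <= u n].
have PF : ProperFilter (within S \oo).
  split; last exact: within_filter.
  move=> /= S0.
  have : (d%:E < ereal_sup [set (u n)%:E | n in [set n | S n -> set0 n]])%E.
    apply: (lt_le_trans du); apply: ereal_inf_lbound => /=.
    by exists [set n | S n -> set0 n].
  move/ereal_sup_gt => [_ [n /= Sn <-]]; rewrite lte_fin => dn.
  by apply: Sn; exact: ltW.
have [U [UU sU]] := ultraFilterLemma PF; exists U; split=> //.
  by move=> A A0; apply: sU; apply: filterS A0 => n An _.
by apply: sU; apply: (@filterS _ \oo _ setT) => //; exact: filterT.
Qed.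

Lemma ultra_bounded_cvg {R : realType} (U : set_system nat) (u : nat -> R)
    (M : R) :
  UltraFilter U -> (forall n, `|u n| <= M) -> cvg (u n @[n --> U]).
Proof.
move=> UU uM.
have := @segment_compact R (- M) M; rewrite compact_ultra => cM.
have UV : UltraFilter (u n @[n --> U]).
  split; first exact: fmap_proper_filter.
  move=> G PG sG; apply/seteqP; split=> // A GA.
  have [//|UA] := in_ultra_setVsetC (u @^-1` A) UU.
  have GC : G (~` A) by apply: sG.
  exfalso; apply: (@filter_not_empty _ G PG).
  by rewrite -(setICr A); exact: filterI.
have [|l [_ ul]] := cM _ UV.
  apply: (@filterS _ U _ setT); last exact: filterT.
  by move=> n _ /=; rewrite in_itv/= -ler_norml.
by apply/cvg_ex; exists l.
Qed.

(** The mean is the limit, along an ultrafilter selecting a dense subsequence,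
    of the averages over a Folner sequence on which E has positive upper
    density.  It is a function on all of [K -> R], but its linearity and
    monotonicity are restricted to bounded functions, for which the limit
    exists. *)
Lemma invariant_mean {R : realType} {K : zmodType} (E : set K) :
  (0 < upper_banach_density R E)%E ->
  exists (d : R) (L : (K -> R) -> R), [/\ 0 < d,
   forall a f g, bounded f -> bounded g ->
     L (fun x => a * f x + g x) = a * L f + L g,
   forall a, L (fun=> a) = a,
   forall f g, bounded f -> bounded g -> (forall x, f x <= g x) -> L f <= L g
 & (forall f b, bounded f -> L (fun x => f (x + b)) = L f)
   /\ d <= L (fun x => (x \in E)%:R) ].
Proof.
move=> /ereal_sup_gt [_ [F /= [F0 Fb] <-]] dpos.
set u := relative_density R E F in dpos.
have [d d0 du] : exists2 d : R,
    0 < d & (d%:E < limn_esup (fun n => (u n)%:E))%E.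
  case: limn_esup dpos => [r||] //; last by move=> _; exists 1; rewrite ?ltry.
  by rewrite lte_fin => r0; exists (r / 2); rewrite ?lte_fin; lra.
have [U [UU ooU Ud]] := limn_esup_ultra _ _ du.
have PU : ProperFilter U by exact: ultra_proper.
pose av f n := average (F n) f : R.
have avcvg f : bounded f -> cvg (av f n @[n --> U]).
  by move=> [M fM]; apply: (ultra_bounded_cvg _ _ M) => n; exact: average_bound.
exists d, (fun f => lim (av f n @[n --> U])); split=> //.
- move=> a f g bf bg; apply: cvg_lim => //.
  rewrite /av (_ : (fun n => _) = (fun n => a * av f n + av g n)); last first.
    by apply/funext => n; rewrite averageD averageZ.
  by apply: cvgD; [apply: cvgMr; exact: avcvg|exact: avcvg].
- move=> a; rewrite /av; under eq_fun do rewrite average_cst//.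
  exact: lim_cst.
- move=> f g bf bg fg; apply: ler_lim; [exact: avcvg|exact: avcvg|].
  by apply: nearW => n; exact: le_average.
split.
- move=> f b bf; have [M fM] := bf.
  apply/subr0_eq; rewrite -limB; [|apply: avcvg|exact: avcvg]; last first.
    by exists M.
  apply: cvg_lim => //.
  apply: (@squeeze_cvgr _ _ _ _
    (fun n => - (2 * M * (1 - folner_ratio R F b n)))
    (fun n => 2 * M * (1 - folner_ratio R F b n))).
  + by apply: nearW => n; rewrite -ler_norml; exact: average_shift.
  + rewrite -oppr0; apply: cvgN; rewrite -[X in _ --> X](mulr0 (2 * M)).
    apply: cvgMr; rewrite -[X in _ --> X](subrr 1).
    apply: cvgB; first exact: cvg_cst.
    exact: cvg_trans (cvg_app _ ooU) (Fb b).
  + rewrite -[X in _ --> X](mulr0 (2 * M)).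
    apply: cvgMr; rewrite -[X in _ --> X](subrr 1).
    apply: cvgB; first exact: cvg_cst.
    exact: cvg_trans (cvg_app _ ooU) (Fb b).
apply: limr_ge.
  by apply: avcvg; exists 1 => x; case: (x \in E); rewrite ?normr1 ?normr0.
apply: filterS Ud => n /= /le_trans; apply.
rewrite /u /relative_density /av /average ler_pM2r; last first.
  by rewrite invr_gt0 ltr0n cardfs_gt0.
rewrite (big_fsetID _ (fun x => x \in E)) /=.
rewrite -[leLHS]addr0 lerD ?sumr_ge0//.
rewrite -[leLHS]mulr1 mulr_natl -[#|` _|]count_predT -iter_addr_0.
rewrite -big_const_seq.
rewrite [leLHS]big_seq [leRHS]big_seq; apply: ler_sum => x.
by rewrite !inE => /andP[_ ->].
Qed.

(** * Correlation functions of sets of positive density *)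

(** A list of pairs (weight, point) stands for a finitely supported signed
    measure on K; the form is the pairing of two of them against the kernel
    phi (x - y). *)
Definition corr_form {R : realType} {K : zmodType} (phi : K -> R)
    (s t : seq (R * K)) : R :=
  \sum_(p <- s) \sum_(q <- t) p.1 * q.1 * phi (p.2 - q.2).

Lemma corr_form_catl {R : realType} {K : zmodType} (phi : K -> R) s s' t :
  corr_form phi (s ++ s') t = corr_form phi s t + corr_form phi s' t.
Proof. by rewrite /corr_form big_cat. Qed.

Lemma corr_formC {R : realType} {K : zmodType} (phi : K -> R) s t :
  (forall r, phi (- r) = phi r) -> corr_form phi s t = corr_form phi t s.
Proof.
move=> phiN; rewrite /corr_form exchange_big; apply: eq_bigr => p _.
by apply: eq_bigr => q _; rewrite -phiN opprB (mulrC p.1).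
Qed.

Lemma corr_form_catr {R : realType} {K : zmodType} (phi : K -> R) s t t' :
  (forall r, phi (- r) = phi r) ->
  corr_form phi s (t ++ t') = corr_form phi s t + corr_form phi s t'.
Proof.
by move=> phiN; rewrite corr_formC// corr_form_catl !(corr_formC _ s).
Qed.

(** For r |-> m (E /\ (E - r)), with m an invariant mean giving E measure d, the
    last condition is the Cauchy-Schwarz inequality between a combination of
    translates of the indicator of E and the constant 1. *)
Definition correlation {R : realType} {K : zmodType} (d : R) (phi : K -> R)
    : Prop :=
  [/\ forall r, 0 <= phi r <= 1, forall r, phi (- r) = phi r
    & forall s, (d * \sum_(p <- s) p.1) ^+ 2 <= corr_form phi s s].

(** Take phi r to be the mean of the product of the indicator of E and its
    translate by r: the form of phi on s is the mean of g ^ 2, where g is the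
    s-combination of translates, and the mean of g ^ 2 is at least the square of
    the mean of g. *)
Lemma density_correlation {R : realType} {K : zmodType} (E : set K) :
  (0 < upper_banach_density R E)%E ->
  exists (d : R) (phi : K -> R), [/\ 0 < d, correlation d phi
    & forall r, phi r != 0 -> difference_set E r].
Proof.
move=> /invariant_mean [d [L [d0 Llin Lcst Lmono [Lshift Ld]]]].
pose e x : R := (x \in E)%:R.
have be b : bounded (fun x => e (x + b)).
  by exists 1 => x; rewrite /e; case: (_ \in _); rewrite ?normr1 ?normr0.
have be0 : bounded e by have := be 0; under eq_fun do rewrite addr0.
have bee a b : bounded (fun x => e (x + a) * e (x + b)) by exact: boundedM.
have bee0 a : bounded (fun x => e (x + a) * e x) by exact: boundedM.
have Lsum (I : Type) (s : seq I) (c : I -> R) (f : I -> K -> R) :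
    (forall i, bounded (f i)) ->
    L (fun x => \sum_(i <- s) c i * f i x) = \sum_(i <- s) c i * L (f i).
  move=> bf; elim: s => [|i s IHs].
    rewrite big_nil (_ : (fun _ => _) = (fun=> 0)) ?Lcst//.
    by apply/funext => x; rewrite big_nil.
  rewrite big_cons -IHs -Llin//; last first.
    by apply: bounded_sum => j; apply: boundedM => //; exact: bounded_cst.
  by congr L; apply/funext => x; rewrite big_cons.
pose phi r := L (fun x => e (x + r) * e x).
have Lphi a b : L (fun x => e (x + a) * e (x + b)) = phi (a - b).
  rewrite -(Lshift _ (- b))//; congr L; apply/funext => x.
  by rewrite addrNK -addrA (addrC _ a).
exists (L e), phi; split; first exact: lt_le_trans d0 Ld.
  split=> [r|r|s].
  - apply/andP; split.
      rewrite -(Lcst 0); apply: Lmono => //; first exact: bounded_cst.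
      by move=> x; rewrite /e mulr_ge0 ?ler0n.
    rewrite -(Lcst 1); apply: Lmono => //; first exact: bounded_cst.
    by move=> x; rewrite /e -natrM (ler_nat _ _ 1); do 2! case: (_ \in _).
  - rewrite -{2}(subr0 r) -Lphi -sub0r -Lphi; congr L.
    by apply/funext => x; rewrite mulrC.
  pose g x := \sum_(p <- s) p.1 * e (x + p.2).
  have bg : bounded g.
    by apply: bounded_sum => p; apply: boundedM => //; exact: bounded_cst.
  have Lg : L g = L e * \sum_(p <- s) p.1.
    rewrite Lsum// mulr_sumr; apply: eq_bigr => p _.
    by rewrite Lshift// mulrC.
  have Lgg : L (fun x => g x * g x) = corr_form phi s s.
    rewrite (_ : (fun x => _) = (fun x => \sum_(p <- s) p.1 *
        (\sum_(q <- s) q.1 * (e (x + p.2) * e (x + q.2))))).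
      rewrite Lsum; last first.
        move=> p; apply: bounded_sum => q.
        by apply: boundedM => //; exact: bounded_cst.
      apply: eq_bigr => p _; rewrite Lsum// mulr_sumr.
      by apply: eq_bigr => q _; rewrite Lphi mulrA.
    apply/funext => x; rewrite /g mulr_suml; apply: eq_bigr => p _.
    rewrite -mulrA; congr (_ * _); rewrite mulr_sumr; apply: eq_bigr => q _.
    by rewrite mulrCA.
  have bgg : bounded (fun x => g x * g x) by exact: boundedM.
  rewrite -Lg -Lgg; set c := L g.
  (* The mean of (g - c) ^ 2 is nonnegative, and c is the mean of g. *)
  have : 0 <= L (fun x => (- (2 * c)) * g x + (1 * (g x * g x) + c ^+ 2)).
    rewrite -(Lcst 0); apply: Lmono; first exact: bounded_cst.
      apply: boundedD; first by apply: boundedM => //; exact: bounded_cst.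
      apply: boundedD; last exact: bounded_cst.
      by apply: boundedM => //; exact: bounded_cst.
    move=> x; have -> : - (2 * c) * g x + (1 * (g x * g x) + c ^+ 2)
      = (g x - c) ^+ 2 by ring.
    exact: sqr_ge0.
  rewrite Llin//; last first.
    by apply: boundedD; [apply: boundedM => //|]; exact: bounded_cst.
  rewrite Llin//; last exact: bounded_cst.
  rewrite Lcst -/c; nra.
move=> r phir; apply: contrapT => Er; move/eqP: phir; apply.
rewrite /phi -[RHS](Lcst 0); congr L; apply/funext => x; rewrite /e.
case: (boolP (x \in E)) => xE; rewrite ?mulr0//.
case: (boolP (x + r \in E)) => xrE; rewrite ?mul0r//.
case: Er; rewrite !inE in xE xrE; exists (x + r) => //; exists x => //.
by rewrite addrAC subrr add0r.
Qed.

Lemma correlation_scale {R : realType} {K : fieldType} (d : R) (phi : K -> R)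
    (c : K) :
  correlation d phi -> correlation d (fun r => phi (c * r)).
Proof.
move=> [phi01 phiN phid]; split=> [r|r|s]; first exact: phi01.
  by rewrite mulrN phiN.
have := phid [seq (p.1, c * p.2) | p <- s]; rewrite big_map.
congr (_ <= _); rewrite /corr_form big_map; apply: eq_bigr => p _.
by rewrite big_map; apply: eq_bigr => q _; rewrite mulrBr.
Qed.

(** * Difference sets are multiplicatively thickly syndetic *)

(** Pairs are coloured in the order in which they occur in s, so that r is not
    required to be symmetric. *)
Lemma ramsey {T : eqType} (r : rel T) (m n : nat) (s : seq T) :
  (2 ^ (m + n) <= size s)%N ->
  exists t, subseq t s /\ ((size t = m /\ pairwise r t) \/
    (size t = n /\ pairwise (fun x y => ~~ r x y) t)).
Proof.
elim: m n s => [|m IHm] n s; first by exists [::]; split; [exact: sub0seq|left].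
elim: n s => [|n IHn] s; first by exists [::]; split; [exact: sub0seq|right].
case: s => [|x s]; first by rewrite leqn0 expn_eq0.
rewrite /= addnS expnS mul2n -addnn => szs.
have := count_predC (r x) s; rewrite -!size_filter => szr.
have [big|small] := leqP (2 ^ (m.+1 + n)) (size [seq y <- s | predC (r x) y]).
  have [t [ts tP]] := IHn _ big.
  have ts' := subseq_trans ts (filter_subseq _ _).
  case: tP => [[tm tr]|[tn tr]].
    by exists t; split; [exact: subseq_trans ts' (subseq_cons _ _)|left].
  exists (x :: t); split; first by rewrite /= eqxx.
  right; split; first by rewrite /= tn.
  rewrite /= tr andbT; apply/allP => y /(mem_subseq ts).
  by rewrite mem_filter => /andP[].
have [|t [ts tP]] := IHm n.+1 [seq y <- s | r x y].
  rewrite addnS -addSn; move: szs szr small.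
  move: (2 ^ _)%N (size s) (size (seq.filter _ _)) (size (seq.filter _ _)).
  move=> a b c e.
  by lia.
have ts' := subseq_trans ts (filter_subseq _ _).
case: tP => [[tm tr]|[tn tr]].
  exists (x :: t); split; first by rewrite /= eqxx.
  left; split; first by rewrite /= tm.
  rewrite /= tr andbT; apply/allP => y /(mem_subseq ts).
  by rewrite mem_filter => /andP[].
by exists t; split; [exact: subseq_trans ts' (subseq_cons _ _)|right].
Qed.

(** The finitary form of a Delta-star set, one that meets the
    differences of every long enough sequence. *)
Definition delta_star {K : zmodType} (N : nat) (S : set K) : Prop :=
  forall s, uniq s -> size s = N -> ~~ pairwise (fun x y => x - y \notin S) s.

Lemma delta_star_pair {K : zmodType} (N : nat) (S : set K) (s : seq K) :
  delta_star N S -> uniq s -> size s = N ->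
  exists x y, [/\ x \in s, y \in s, x != y & S (x - y)].
Proof.
move=> SN us sN; apply: contrapT => no; have := SN s us sN.
move/negP; apply; move: (us); rewrite uniq_pairwise.
apply: (@sub_in_pairwise _ (mem s)); last by apply/allP.
move=> x y xs ys xy; apply/negP; rewrite inE => Sxy.
by apply: no; exists x, y.
Qed.

(** Colour the pairs of a sequence according to whether their difference lies in
    S: a large monochromatic subsequence is excluded by S in one colour, and in
    the other one it contains a difference from T. *)
Lemma delta_starI {K : zmodType} (M N : nat) (S T : set K) :
  delta_star M S -> delta_star N T -> delta_star (2 ^ (M + N)) (S `&` T).
Proof.
move=> SM TN s us ss; apply/negP => sST.
have [|t [ts tP]] := ramsey (fun x y => x - y \notin S) M N s.
  by rewrite ss.
have ut := subseq_uniq ts us; case: tP => [[tM tS]|[tN tS]].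
  by move: (SM t ut tM); rewrite tS.
have /negP := TN t ut tN; apply.
have := subseq_pairwise ts sST; move: tS; elim: t {ts ut tN} => //= x t IHt.
move=> /andP[/allP xS tS] /andP[/allP xST tST]; rewrite IHt// andbT.
apply/allP => y yt; move: (xS y yt) (xST y yt); rewrite negbK in_setI.
by move=> ->.
Qed.

Lemma delta_star_scale {K : fieldType} (N : nat) (S : set K) (c : K) :
  c != 0 -> delta_star N S -> delta_star N [set x | S (c * x)].
Proof.
move=> c0 SN s us sN.
have := SN (map ( *%R c) s); rewrite size_map map_inj_uniq; last exact: mulfI.
move=> /(_ us sN); rewrite pairwise_map; congr (~~ _).
apply: eq_pairwise => x y.
by rewrite /= -mulrBr; congr (~~ _); apply/idP/idP; rewrite !inE.
Qed.

Lemma delta_star_scales {K : fieldType} (N : nat) (S : set K) (cs : seq K) :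
  0 \notin cs -> delta_star N S ->
  exists M, delta_star M [set x | forall c, c \in cs -> S (c * x)].
Proof.
move=> + SN; elim: cs => [_|c cs IHcs].
  exists 2%N => -[|x [|y []]]//= _ _; rewrite andbT negb_and /=.
  by rewrite orbF negbK inE.
rewrite inE negb_or eq_sym => /andP[c0 /IHcs[M csM]].
have := delta_starI _ _ _ _ (delta_star_scale _ _ _ c0 SN) csM.
set N' := (2 ^ _)%N => H; exists N'; move: H; congr (delta_star _ _).
apply/seteqP; split=> [x /= [Sc Scs] e|x /= Scs].
  by rewrite inE => /predU1P[->//|/Scs].
by split=> [|e ecs]; apply: Scs; rewrite inE ?eqxx// ecs orbT.
Qed.

Lemma infinite_uniq_seq {K : choiceType} (n : nat) :
  infinite_set [set: K] -> exists s : seq K, uniq s /\ size s = n.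
Proof.
move=> /(infinite_set_fset n)[B _ nB]; exists (take n B).
by rewrite take_uniq ?fset_uniq// size_takel.
Qed.

(** Fix N distinct points; for any y != 0 their dilates by y are still N
    distinct points, so one of finitely many differences, dilated by y, is in S. *)
Lemma delta_star_syndetic {K : fieldType} (N : nat) (S : set K) :
  infinite_set [set: K] -> delta_star N S ->
  exists ds : seq K, 0 \notin ds /\
    forall y, y != 0 -> exists2 d, d \in ds & S (d * y).
Proof.
move=> /(infinite_uniq_seq N)[s [us sN]] SN.
exists [seq d <- [seq x - y | x <- s, y <- s] | d != 0].
split=> [|y y0]; first by rewrite mem_filter eqxx.
have [a [b [as_ bs ab Sab]]] :=
  delta_star_pair _ _ _ (delta_star_scale _ _ _ y0 SN) us sN.
exists (a - b); last by rewrite mulrC.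
by rewrite mem_filter subr_eq0 ab; apply/allpairsP; exists (a, b).
Qed.

(** If N points have all their differences outside the support of phi, then the
    form of phi on the sum of their point masses reduces to its diagonal, at
    most N, whereas it is at least (d N) ^ 2. *)
Lemma correlation_delta_star {R : realType} {K : zmodType} (d : R) :
  0 < d -> exists N, forall phi : K -> R, correlation d phi ->
    delta_star N [set r | phi r != 0].
Proof.
move=> d0; exists (Num.truncn (d ^- 2)).+1 => phi [phi01 phiN phid] s us sN.
apply/negP => off; have := phid [seq (1, x) | x <- s].
have sub : \sum_(p <- [seq (1 : R, x) | x <- s]) p.1 = (size s)%:R.
  by rewrite big_map big_const_seq count_predT iter_addr_0.
suff : corr_form phi [seq (1, x) | x <- s] [seq (1, x) | x <- s] <= (size s)%:R.
  rewrite sub => h /le_trans/(_ h); apply/negP; rewrite -ltNge exprMn.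
  rewrite [X in _ * X]expr2 mulrA -[ltLHS]mul1r ltr_pM2r ?sN ?ltr0n//.
  by rewrite -ltr_pdivrMl ?exprn_gt0// mulr1 truncnS_gt.
have off0 x y : x \in s -> y \in s -> x != y -> phi (x - y) = 0.
  move=> xs ys xy; pose r a b := (a == b) || (phi (a - b) == 0).
  have : all2rel r s.
    rewrite -pairwise_all2rel; last 2 first.
    - by move=> a; rewrite /r eqxx.
    - by move=> a b; rewrite /r eq_sym -phiN opprB.
    apply: sub_pairwise off => a b ab; apply/orP; right.
    by apply: contraNT ab => ab; rewrite in_setE.
  by move=> /allrelP /(_ x y xs ys); rewrite /r (negbTE xy) => /eqP.
rewrite /corr_form big_map -sub big_map [leLHS]big_seq [leRHS]big_seq.
apply: ler_sum => x xs; rewrite big_map (bigD1_seq x)//= big1_seq.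
  by rewrite addr0 subrr !mul1r; case/andP: (phi01 0).
by move=> y /andP[yx ys]; rewrite off0 ?mulr0// eq_sym.
Qed.

(** A combination of thickness and syndeticity: the w such that T
    contains c w xs are found, by syndeticity, in every dilate of a finite set
    ds, while thickness gives a v such that S contains all v / (d x) with d in
    ds and x in xs.  Then w = d / v works for the appropriate d. *)
Lemma delta_star_inverse {K : fieldType} (M N : nat) (S T : set K) (c : K)
    (xs : seq K) :
  infinite_set [set: K] -> c != 0 -> 0 \notin xs ->
  delta_star M S -> delta_star N T ->
  exists2 w, w != 0 &
    forall x, x \in xs -> S (w * x)^-1 /\ T (c * (w * x)).
Proof.
move=> Kinf c0 xs0 SM TN.
have nz (f : K -> K) (s : seq K) : (forall x, x != 0 -> f x != 0) ->
    0 \notin s -> 0 \notin map f s.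
  move=> f0 s0; apply/negP => /mapP[x xs' /esym/eqP]; apply/negP/f0.
  by apply: contraNneq s0 => <-.
have [N' TN'] := delta_star_scales _ _ [seq c * x | x <- xs]
  (nz _ _ (fun x x0 => mulf_neq0 c0 x0) xs0) TN.
have [ds [ds0 dsP]] := delta_star_syndetic _ _ Kinf TN'.
have inv0 (x : K) : x != 0 -> x^-1 != 0 by rewrite invr_eq0.
have [M' SM'] := delta_star_scales _ _ [seq x^-1 | x <- xs]
  (nz _ _ inv0 xs0) SM.
have [M'' SM''] := delta_star_scales _ _ [seq x^-1 | x <- ds]
  (nz _ _ inv0 ds0) SM'.
have [vs [vs0 vsP]] := delta_star_syndetic _ _ Kinf SM''.
have [v vvs Sv] := vsP 1 (oner_neq0 _).
have v0 : v != 0 by apply: contraNneq vs0 => <-.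
have [d dds Td] := dsP _ (inv0 _ v0).
have d0 : d != 0 by apply: contraNneq ds0 => <-.
exists (d / v) => [|x xxs]; first by rewrite mulf_neq0// inv0.
split; last first.
  by rewrite (mulrC (d / v)) mulrA; apply: Td; exact: map_f.
have := Sv d^-1 (map_f _ dds) x^-1 (map_f _ xxs).
by rewrite mulr1 !invfM invrK mulrC.
Qed.

(** * Recurrence along squares *)

(** Folner's condition, tested against functions with values in [0, 1] so that
    it can be applied directly to correlation functions. *)
Definition amenable (R : realType) (K : zmodType) : Prop :=
  forall (bs : seq K) (e : R), 0 < e -> exists X : seq K, X != [::] /\
    forall b (f : K -> R), b \in bs -> (forall x, 0 <= f x <= 1) ->
      \sum_(x <- X) f x - \sum_(x <- X) f (x + b) <= e * (size X)%:R.

Lemma density_amenable {R : realType} {K : zmodType} (E : set K) :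
  (0 < upper_banach_density R E)%E -> amenable R K.
Proof.
move=> /ereal_sup_gt [_ [F /= [F0 Fb] _] _] bs e e0.
have close : \forall n \near \oo, forall b, b \in bs ->
    2 * (1 - folner_ratio R F b n) <= e.
  elim: bs => [|b bs IHbs]; first by near=> n.
  have e2 : 0 < e / 2 by rewrite divr_gt0.
  near=> n => b'; rewrite inE => /predU1P[->|b'bs]; last first.
    by move: b' b'bs; near: n.
  have : `|1 - folner_ratio R F b n| <= e / 2.
    by near: n; apply: cvgr_dist_le e2; exact: Fb.
  by rewrite ler_norml => /andP[_ h]; lra.
have [n nP] : exists n, forall b, b \in bs ->
    2 * (1 - folner_ratio R F b n) <= e.
  exact: filter_ex close.
exists (F n); split.
  by have := F0 n; rewrite -cardfs_eq0 -size_eq0.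
move=> b f bbs f01.
have f1 x : `|f x| <= 1.
  by case/andP: (f01 x) => h0 h1; rewrite ger0_norm.
have := le_trans (average_shift (F n) b f 1 (F0 n) f1) _ .
move=> /(_ e); rewrite mulr1 => /(_ (nP b bbs)).
have F1 : 0 < #|` F n|%:R :> R by rewrite ltr0n cardfs_gt0.
rewrite ler_norml => /andP[h _]; move: h.
by rewrite /average -mulrBl ler_pdivlMr// mulNr lerNl opprB.
Unshelve. all: by end_near. Qed.

(** The inequality 2 l <u, v> <= <u, u> + l ^ 2 <v, v> for the form of phi, with
    v the point mass at z and u the difference of the
    point masses on ys and their translates by a.  Keeping the parameter l
    avoids square roots when these inequalities are summed. *)
Lemma correlation_cauchy {R : realType} {K : zmodType} (d : R) (phi : K -> R)
    (ys : seq K) (a z : K) (l : R) :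
  correlation d phi ->
  2 * l * \sum_(y <- ys) (phi (y + a - z) - phi (y - z)) <=
  \sum_(y <- ys) \sum_(y' <- ys)
     (2 * phi (y - y') - phi (y - y' + a) - phi (y - y' - a)) + l ^+ 2.
Proof.
move=> [phi01 phiN phid].
pose A := [seq (1 : R, y + a) | y <- ys].
pose B := [seq (- 1 : R, y) | y <- ys].
pose Z := [:: (- l, z)].
have := le_trans (sqr_ge0 _) (phid (A ++ B ++ Z)).
rewrite !corr_form_catl !corr_form_catr//.
rewrite (corr_formC _ B A)// (corr_formC _ Z A)// (corr_formC _ Z B)//.
have AA : corr_form phi A A = \sum_(y <- ys) \sum_(y' <- ys) phi (y - y').
  rewrite /corr_form big_map; apply: eq_bigr => y _; rewrite big_map.
  by apply: eq_bigr => y' _; rewrite !mul1r /= opprD addrACA subrr addr0.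
have BB : corr_form phi B B = \sum_(y <- ys) \sum_(y' <- ys) phi (y - y').
  rewrite /corr_form big_map; apply: eq_bigr => y _; rewrite big_map.
  by apply: eq_bigr => y' _; rewrite mulrNN !mul1r.
have AB : corr_form phi A B = - \sum_(y <- ys) \sum_(y' <- ys) phi (y - y' + a).
  rewrite /corr_form big_map -sumrN; apply: eq_bigr => y _; rewrite big_map.
  by rewrite -sumrN; apply: eq_bigr => y' _; rewrite mul1r mulN1r addrAC.
have AB' : corr_form phi A B =
    - \sum_(y <- ys) \sum_(y' <- ys) phi (y - y' - a).
  rewrite corr_formC// /corr_form big_map -sumrN; apply: eq_bigr => y _.
  rewrite big_map -sumrN; apply: eq_bigr => y' _.
  by rewrite mulr1 mulN1r opprD addrA.
have AZ : corr_form phi A Z = - (l * \sum_(y <- ys) phi (y + a - z)).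
  rewrite /corr_form big_map mulr_sumr -sumrN; apply: eq_bigr => y _.
  by rewrite big_seq1 mul1r mulNr.
have BZ : corr_form phi B Z = l * \sum_(y <- ys) phi (y - z).
  rewrite /corr_form big_map mulr_sumr; apply: eq_bigr => y _.
  by rewrite big_seq1 mulN1r opprK.
have ZZ : corr_form phi Z Z <= l ^+ 2.
  rewrite /corr_form !big_seq1 subrr /= mulrNN -expr2.
  by rewrite ler_piMr ?sqr_ge0//; case/andP: (phi01 0).
have -> : \sum_(y <- ys) \sum_(y' <- ys)
     (2 * phi (y - y') - phi (y - y' + a) - phi (y - y' - a)) =
     2 * corr_form phi A A + corr_form phi A B + corr_form phi A B.
  rewrite {1}AB AB' AA mulr_sumr -!sumrN -!big_split; apply: eq_bigr => y _.
  by rewrite mulr_sumr -!sumrN -!big_split.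
have -> : \sum_(y <- ys) (phi (y + a - z) - phi (y - z)) =
    \sum_(y <- ys) phi (y + a - z) - \sum_(y <- ys) phi (y - z).
  by rewrite big_split sumrN.
move: AZ BZ ZZ; rewrite AA BB.
move: (corr_form _ _ _) (corr_form _ _ _) (corr_form _ _ _) (corr_form _ _ _).
by move=> *; nra.
Qed.

Lemma infinite_avoid {K : choiceType} (s : seq K) :
  infinite_set [set: K] -> exists x, x \notin s.
Proof.
move=> Kinf; apply: contrapT => no; apply: Kinf.
apply: (sub_finite_set _ (finite_seq s)) => x _ /=.
by apply: contrapT => /negP xs; apply: no; exists x.
Qed.

(** Van der Corput differencing.  D consists of the sums x + h with x in a long
    almost invariant X and h in a fixed H of n elements.  For fixed x, the
    Cauchy-Schwarz inequality bounds the sum over h by the sum over h, h' of the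
    second differences with step a of phi at
    -2 x (h - h') - (h ^ 2 - h' ^ 2).  The n diagonal terms are few; in
    the others this point is moved by a when x is moved by a / (2 (h - h')), and
    almost invariance of X makes the sum over x small. *)
Lemma square_averages {R : realType} {K : fieldType} (xs : seq K) (e : R) :
  amenable R K -> infinite_set [set: K] -> 2 != 0 :> K -> 0 < e ->
  exists D : seq K, [/\ D != [::], 0 \notin D &
    forall d phi, correlation d phi -> forall a, a \in xs ->
      \sum_(x <- D) (phi (x ^+ 2 - a) - phi (x ^+ 2)) <= e * (size D)%:R].
Proof.
move=> amen Kinf two0 e0; set n := (Num.truncn (4 / e ^+ 2)).+1.
have [H [uH sH]] := infinite_uniq_seq n Kinf.
have ne : 4 <= n%:R * e ^+ 2.
  by rewrite -ler_pdivrMr ?exprn_gt0// ltW// truncnS_gt.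
pose bs := [seq a / (2 * g) | a <- xs, g <- [seq h - h' | h <- H, h' <- H]].
have [X0 [X00 X0inv]] : exists X : seq K, X != [::] /\
    forall b (f : K -> R), b \in bs -> (forall x, 0 <= f x <= 1) ->
      \sum_(x <- X) f x - \sum_(x <- X) f (x + b) <= e ^+ 2 / 4 * (size X)%:R.
  by apply: amen; rewrite divr_gt0 ?exprn_gt0.
(* Translating X0 by x0 keeps it almost invariant and makes every x + h
   nonzero. *)
have [x0 x0P] := infinite_avoid [seq - (x + h) | x <- X0, h <- H] Kinf.
pose X := [seq x + x0 | x <- X0].
have sX : size X = size X0 by rewrite size_map.
have Xinv b (f : K -> R) : b \in bs -> (forall x, 0 <= f x <= 1) ->
    \sum_(x <- X) f x - \sum_(x <- X) f (x + b) <= e ^+ 2 / 4 * (size X)%:R.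
  move=> bbs f01; rewrite sX !big_map.
  have := X0inv b (fun x => f (x + x0)) bbs (fun x => f01 _).
  by under [X in _ - X]eq_bigr do rewrite addrAC.
exists [seq x + h | x <- X, h <- H]; split.
- rewrite -size_eq0 size_allpairs muln_eq0 sX size_eq0 (negbTE X00) sH //.
- apply: contra x0P => /allpairsP [[x h] /= [/mapP[x' x'X ->] hH h0]].
  apply/allpairsP; exists (x', h); split=> //=.
  by apply/eqP; rewrite -addr_eq0 addrC addrAC -h0.
move=> d phi phiC a axs; have [phi01 phiN _] := phiC.
rewrite size_allpairs sH natrM.
have n0 : 0 < n%:R :> R by rewrite ltr0n.
have X0' : 0 <= (size X)%:R :> R by rewrite ler0n.
rewrite big_allpairs_dep.
set S := \sum_(x <- X) _.
pose k x h h' : K := - 2 * x * (h - h') - (h ^+ 2 - h' ^+ 2).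
pose T x := \sum_(h <- H) \sum_(h' <- H)
   (2 * phi (k x h h') - phi (k x h h' + a) - phi (k x h h' - a)).
(* The choice l = n e balances the two error terms, each at most
   |X| (n e) ^ 2. *)
have step : 2 * (n%:R * e) * S <=
    \sum_(x <- X) T x + (size X)%:R * (n%:R * e) ^+ 2.
  have -> : (size X)%:R * (n%:R * e) ^+ 2 = \sum_(x <- X) (n%:R * e) ^+ 2.
    by rewrite big_const_seq count_predT iter_addr_0 mulr_natl.
  rewrite -big_split mulr_sumr; apply: ler_sum => x _ /=.
  have := correlation_cauchy d phi [seq - 2 * x * h - h ^+ 2 | h <- H] a
    (x ^+ 2) (n%:R * e) phiC.
  rewrite !big_map /T; congr (_ * _ <= _ + _).
    apply: eq_bigr => h _; rewrite -phiN; congr (phi _ - _); first by ring.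
    by rewrite -phiN; congr phi; ring.
  apply: eq_bigr => h _; rewrite big_map; apply: eq_bigr => h' _.
  have -> : - 2 * x * h - h ^+ 2 - (- 2 * x * h' - h' ^+ 2) = k x h h'.
    by rewrite /k; ring.
  by [].
suff : \sum_(x <- X) T x <= (size X)%:R * (n%:R * e) ^+ 2.
  have ne0 : 0 < n%:R * e by rewrite mulr_gt0.
  move=> h; have := le_trans step (lerD h (lexx _)).
  set m := n%:R * e => {}h; rewrite -(ler_pM2l ne0) -/m.
  have -> : m * (e * ((size X)%:R * n%:R)) = (size X)%:R * m ^+ 2.
    by rewrite /m; ring.
  lra.
have pair h h' : h \in H -> h' \in H ->
    \sum_(x <- X) (2 * phi (k x h h') - phi (k x h h' + a) - phi (k x h h' - a))
    <= (2 * (h == h')%:R + e ^+ 2 / 2) * (size X)%:R.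
  move=> hH h'H; case: eqVneq => [<-|hh'].
    rewrite mulrDl [leLHS](_ : _ = \sum_(x <- X) (2 * (phi 0 - phi a))).
      rewrite big_const_seq count_predT iter_addr_0 -(mulr_natr (2 * _)).
      apply: ler_wpDr; first by rewrite mulr_ge0// divr_ge0// sqr_ge0.
      rewrite ler_wpM2r// mulr1.
      by have := phi01 0; have := phi01 a; lra.
    apply: eq_bigr => x _; rewrite /k !subrr mulr0 subrr add0r sub0r phiN.
    by ring.
  pose g := h - h'; have g0 : g != 0 by rewrite subr_eq0.
  have g20 : 2 * g != 0 by rewrite mulf_neq0.
  pose f x := phi (k x h h').
  have gbs u u' : u \in H -> u' \in H -> a / (2 * (u - u')) \in bs.
    move=> uM u'M; apply/allpairsP; exists (a, u - u'); split=> //.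
    by apply/allpairsP; exists (u, u').
  (* These two translations of x move k x h h' by - a and by a. *)
  have f1 := Xinv _ f (gbs _ _ hH h'H) (fun x => phi01 _).
  have f2 := Xinv _ f (gbs _ _ h'H hH) (fun x => phi01 _).
  have kb x : f (x + a / (2 * (h - h'))) = phi (k x h h' - a).
    by rewrite /f /k; congr phi; field; rewrite -/g g0.
  have kb' x : f (x + a / (2 * (h' - h))) = phi (k x h h' + a).
    rewrite /f /k; congr phi; field.
    by rewrite two0 andbT -opprB oppr_eq0 -/g.
  rewrite mulr0 add0r; move: f1 f2.
  under [X in _ - X]eq_bigr do rewrite kb.
  under [X in _ -> _ - X <= _ -> _]eq_bigr do rewrite kb'.
  rewrite !sumrB -mulr_sumr -/f; lra.
rewrite /T exchange_big /=.
apply: (@le_trans _ _ (\sum_(h <- H) \sum_(h' <- H)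
    (2 * (h == h')%:R + e ^+ 2 / 2) * (size X)%:R)).
  rewrite big_seq [leRHS]big_seq; apply: ler_sum => h hH.
  rewrite exchange_big big_seq [leRHS]big_seq; apply: ler_sum => h' h'H.
  exact: pair.
rewrite (_ : \sum_(h <- H) _ =
    (2 * n%:R + e ^+ 2 / 2 * n%:R ^+ 2) * (size X)%:R).
  by rewrite [leRHS]mulrC ler_wpM2r//; nra.
rewrite big_seq (eq_bigr (fun h => (2 + e ^+ 2 / 2 * n%:R) * (size X)%:R)).
  rewrite -big_seq big_const_seq count_predT iter_addr_0 sH -mulr_natr; ring.
move=> h hH; rewrite -mulr_suml; congr (_ * _); rewrite big_split /=.
congr (_ + _); last first.
  by rewrite big_const_seq count_predT iter_addr_0 sH mulr_natr.
rewrite (bigD1_seq h)//= eqxx mulr1 big1 ?addr0// => h' /negbTE.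
by rewrite eq_sym => ->; rewrite mulr0.
Qed.

(** Each new set is put at the head of the list and is adapted, by
    square_averages, to the squares of all the elements of the previous ones. *)
Lemma square_scales {R : realType} {K : fieldType} (M : nat) (e : R) :
  amenable R K -> infinite_set [set: K] -> 2 != 0 :> K -> 0 < e ->
  exists Ds : seq (seq K), [/\ size Ds = M,
    forall D, D \in Ds -> D != [::] /\ 0 \notin D &
    forall d phi, correlation d phi ->
      pairwise (fun D D' => all (fun y =>
        \sum_(x <- D) (phi (x ^+ 2 - y ^+ 2) - phi (x ^+ 2))
          <= e * (size D)%:R) D') Ds].
Proof.
move=> amen Kinf two0 e0; elim: M => [|M [Ds [sDs Ds0 DsP]]].
  by exists [::]; split.
have [D [D1 D0 DP]] :=
  square_averages [seq x ^+ 2 | x <- flatten Ds] e amen Kinf two0 e0.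
exists (D :: Ds); split; first by rewrite /= sDs.
  by move=> E; rewrite inE => /predU1P[->//|/Ds0].
move=> d phi phiC; rewrite pairwise_cons (DsP d)// andbT.
apply/allP => E EDs; apply/allP => y yE; apply: (DP d) => //.
by apply: map_f; apply/flattenP; exists E.
Qed.

Lemma ler_sum_mem {R : realType} {T : eqType} (s : seq T) (f g : T -> R) :
  {in s, forall x, f x <= g x} -> \sum_(x <- s) f x <= \sum_(x <- s) g x.
Proof. by move=> fg; rewrite big_seq [leRHS]big_seq; apply: ler_sum. Qed.

(** Let mu D be the uniform probability on the squares of D.  Its form
    with itself is at most 1, and with mu D' for a later D' it is at most e, as
    phi vanishes on the squares of D.  The sum of all mu D has total mass the
    number of sets, and comparing with the lower bound in correlation gives the
    inequality. *)
Lemma almost_orthogonal {R : realType} {K : fieldType} (d e : R) (phi : K -> R)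
    (Ds : seq (seq K)) :
  correlation d phi -> 0 < e -> (forall D, D \in Ds -> D != [::]) ->
  (forall D x, D \in Ds -> x \in D -> phi (x ^+ 2) = 0) ->
  pairwise (fun D D' => all (fun y =>
        \sum_(x <- D) (phi (x ^+ 2 - y ^+ 2) - phi (x ^+ 2))
          <= e * (size D)%:R) D') Ds ->
  (d * (size Ds)%:R) ^+ 2 <= (size Ds)%:R + e * (size Ds)%:R ^+ 2.
Proof.
move=> phiC e0 Ds0 phi0 DsP; have [phi01 phiN phid] := phiC.
pose mu D : seq (R * K) := [seq ((size D)%:R^-1, x ^+ 2) | x <- D].
have szD D : D != [::] -> 0 < (size D)%:R :> R.
  by rewrite -size_eq0 -lt0n ltr0n.
have massD D : D != [::] -> \sum_(p <- mu D) p.1 = 1.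
  move=> /szD D0; rewrite big_map big_const_seq count_predT iter_addr_0.
  by rewrite -(mulr_natr (_^-1)) mulVf// lt0r_neq0.
have mass Es : (forall D, D \in Es -> D != [::]) ->
    \sum_(p <- flatten (map mu Es)) p.1 = (size Es)%:R.
  elim: Es => [|D Es IHEs] Es0; first by rewrite big_nil.
  rewrite /= big_cat /= IHEs => [|E EEs]; last first.
    by apply: Es0; rewrite inE EEs orbT.
  by rewrite massD ?Es0 ?inE ?eqxx// -natr1 addrC.
have diag D : D != [::] -> corr_form phi (mu D) (mu D) <= 1.
  move=> D0; rewrite -(massD D D0); apply: ler_sum_mem => p pD.
  rewrite -[leRHS]mulr1 -[X in _ * X](massD D D0) mulr_sumr.
  apply: ler_sum_mem => q qD; case/andP: (phi01 (p.2 - q.2)) => _ h.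
  rewrite ler_piMr// mulr_ge0//.
    by case/mapP: pD => x _ ->; rewrite invr_ge0.
  by case/mapP: qD => x _ ->; rewrite invr_ge0.
rewrite -mass//.
apply: le_trans (phid _) _; rewrite mass//.
move: Ds0 phi0 DsP; elim: Ds => [|D Ds IHDs] Ds0 phi0.
  by rewrite /corr_form big_nil /= expr0n mulr0 addr0.
rewrite pairwise_cons => /andP[/allP DDs DsP].
have D0 : D != [::] by apply: Ds0; rewrite inE eqxx.
have {}Ds0 E : E \in Ds -> E != [::].
  by move=> EDs; apply: Ds0; rewrite inE EDs orbT.
have phi0D x : x \in D -> phi (x ^+ 2) = 0 by apply: phi0; rewrite inE eqxx.
have {}IHDs := IHDs Ds0
  (fun E x EDs => phi0 E x (mem_behead (s := D :: Ds) EDs)) DsP.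
have cross : corr_form phi (mu D) (flatten (map mu Ds)) <= e * (size Ds)%:R.
  rewrite -mass// mulr_sumr corr_formC//; apply: ler_sum_mem => q qDs.
  case/flattenP: qDs => _ /mapP[E EDs ->] /mapP[y yE ->] /=.
  rewrite big_map /=.
  have := allP (DDs E EDs) y yE.
  rewrite (eq_big_seq (fun x => phi (x ^+ 2 - y ^+ 2))); last first.
    by move=> x xD; rewrite phi0D// subr0.
  rewrite -ler_pdivrMr ?szD// mulr_suml => h.
  rewrite [leRHS]mulrC.
  apply: le_trans (ler_wpM2l _ h); last by rewrite invr_ge0.
  rewrite mulr_sumr; apply: ler_sum => x _.
  by rewrite -mulrA -phiN opprB (mulrC (phi _)).
rewrite /= corr_form_catl !corr_form_catr// (corr_formC _ (flatten _) (mu D))//.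
have := diag D D0; move: IHDs cross; rewrite -natr1.
move: (corr_form _ _ _) (corr_form _ _ _) (corr_form _ _ _) => u v w.
have : 0 <= (size Ds)%:R :> R by [].
nra.
Qed.

(** The finite set ds is uniform over all correlation functions with the same
    lower bound d. *)
Lemma square_recurrence {R : realType} {K : fieldType} (d : R) :
  amenable R K -> infinite_set [set: K] -> 0 < d ->
  exists ds : seq K, 0 \notin ds /\ forall phi, correlation d phi ->
    exists2 x, x \in ds & phi (x ^+ 2) != 0.
Proof.
move=> amen Kinf d0; have [two0|two0] := eqVneq (2 : K) 0.
  have [N NP] := @correlation_delta_star R K d d0.
  have [s [us sN]] := infinite_uniq_seq N Kinf.
  have p2 : 2%N \in [pchar K] by rewrite inE /= two0 eqxx.
  have sqrB (x y : K) : (x - y) ^+ 2 = x ^+ 2 - y ^+ 2.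
    by rewrite sqrrB mulr2n -mulr2n -(mulr_natl (x * y)) two0 mul0r subr0
      -[y ^+ 2 in RHS](oppr_pchar2 p2) opprK.
  exists [seq x <- [seq x - y | x <- s, y <- s] | x != 0].
  split=> [|phi /NP phiN]; first by rewrite mem_filter eqxx.
  have [||_ [_ [/mapP[x xs ->] /mapP[y ys ->] xy nz]]] :=
    delta_star_pair _ _ [seq x ^+ 2 | x <- s] phiN.
  - rewrite map_inj_uniq// => x y /eqP; rewrite -subr_eq0 -sqrB.
    by rewrite sqrf_eq0 subr_eq0 => /eqP.
  - by rewrite size_map.
  exists (x - y); last by rewrite sqrB.
  rewrite mem_filter subr_eq0 (contra_neq _ xy) => [|->//].
  by apply/allpairsP; exists (x, y).
pose e := d ^+ 2 / 2; have e0 : 0 < e by rewrite divr_gt0// exprn_gt0.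
set M := (Num.truncn e^-1).+1.
have eM : 1 < e * M%:R by rewrite -ltr_pdivrMl// mulr1 truncnS_gt.
have [Ds [sDs Ds0 DsP]] := square_scales M e amen Kinf two0 e0.
exists (flatten Ds); split.
  by apply/negP => /flattenP[D /Ds0[_ /negP]].
move=> phi phiC; apply: contrapT => no.
(* With d ^ 2 = 2 e the conclusion reads 2 e M ^ 2 <= M + e M ^ 2, contrary to
   the choice of M. *)
have := almost_orthogonal d e phi Ds phiC e0 (fun D DDs => proj1 (Ds0 D DDs))
  _ (DsP d phi phiC).
rewrite sDs => /(_ _)/wrap[D x DDs xD|].
  apply/eqP; apply: contrapT => /negP nz; apply: no; exists x => //.
  by apply/flattenP; exists D.
have M0 : 0 < M%:R :> R by rewrite ltr0n.
rewrite exprMn; have -> : d ^+ 2 = 2 * e by rewrite /e; field.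
nra.
Qed.

(** * Solving for x, y and z *)

Theorem corollary1p30 (R : realType) (K : fieldType)
  (K_countable : countable [set: K]) (K_infinite : infinite_set [set: K])
  (A B C : set K)
  (A_pos : (0 < upper_banach_density R A)%E)
  (B_pos : (0 < upper_banach_density R B)%E)
  (C_pos : (0 < upper_banach_density R C)%E) :
  [set p : K * K | exists x y z : K,
     [/\ difference_set A x, difference_set B y, difference_set C z
       & p = (x ^+ 3 * y * z, x * z)]]
  = [set p : K * K | p.2 != 0] `|` [set (0, 0)].
Proof.
have [a [phiA [a0 phiAC diffA]]] := density_correlation A A_pos.
have [b [phiB [b0 phiBC diffB]]] := density_correlation B B_pos.
have [c [phiC [c0 phiCC diffC]]] := density_correlation C C_pos.
have diff0 (E : set K) (d : R) (phi : K -> R) : 0 < d -> correlation d phi ->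
    (forall r, phi r != 0 -> difference_set E r) -> difference_set E (0 : K).
  move=> d0 [_ _ /(_ [:: (1 : R, 0)])]; rewrite /corr_form !big_seq1 /= !mul1r.
  rewrite mulr1 subrr => phi0; apply.
  by rewrite gt_eqF// (lt_le_trans _ phi0)// exprn_gt0.
apply/seteqP; split=> [_ [x [y [z [_ _ _ ->]]]]|[s t]] /=.
  have [xz0|xz] := eqVneq (x * z) 0; [right|by left].
  move/eqP: xz0; rewrite mulf_eq0 => /orP[]/eqP->; last by rewrite !mulr0.
  by rewrite expr0n !mul0r.
move=> [/= t0|[-> ->]]; last first.
  exists 0, 0, 0; split; rewrite ?mulr0//.
  - exact: diff0 a0 phiAC diffA.
  - exact: diff0 b0 phiBC diffB.
  - exact: diff0 c0 phiCC diffC.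
have [ds [ds0 dsP]] :=
  square_recurrence b (density_amenable B B_pos) K_infinite b0.
have [M MP] := @correlation_delta_star R K a a0.
have [N NP] := @correlation_delta_star R K c c0.
have [w w0 wP] := delta_star_inverse M N _ _ t ds K_infinite t0 ds0
  (MP _ phiAC) (NP _ phiCC).
(* For s = 0 the dilated function is the constant phiB 0, still a correlation
   function, and y below is 0. *)
have [d dds phid] := dsP _ (correlation_scale b phiB (s / t * w ^+ 2) phiBC).
have [/= Sd Td] := wP d dds.
exists (w * d)^-1, (s / t * w ^+ 2 * d ^+ 2), (t * (w * d)).
split; [exact: diffA|exact: diffB|exact: diffC|].
have d0 : d != 0 by apply: contraNneq ds0 => <-.
by congr pair; field; rewrite ?t0 ?w0 ?d0.
Qed.
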